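(* Let $\mathbf{a},\mathbf{b}\in V$ be nonzero vectors with $\vert\mathbf{a}\vert=\vert\mathbf{b}\vert$, let $\varphi$ be the angle between them, and let $\mathbf{e}\in V$ be a unit vector perpendicular to both $\mathbf{a}$ and $\mathbf{b}$ such that $\{\mathbf{a},\mathbf{b},\mathbf{e}\}$ is a right-handed set. Let $A=0+\mathbf{a}$ and $B=0+\mathbf{b}$ be the corresponding pure quaternions in $\mathcal{Q}$, and put $Q=\cos\varphi+\sin\varphi\,\mathbf{e}\in\mathcal{Q}$. Then $$\cos\varphi+\sin\varphi\,\mathbf{e}=B\wedge_{\mathcal{Q}}A^{-1},$$ and consequently $$B=Q\wedge_{\mathcal{Q}}A=\mathbf{a}\cos\varphi+(\mathbf{e}\times\mathbf{a})\sin\varphi .$$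
   Context: Let $V$ be the real three-dimensional space with basis $\mathbf{e}_i,\mathbf{e}_j,\mathbf{e}_k$ (labels ordered $i<j<k$), all three time-like: the dot product is the bilinear form with $\mathbf{e}_p\cdot\mathbf{e}_q=\Delta_{pq}$, where $\Delta_{ii}=\Delta_{jj}=\Delta_{kk}=-1$ and $\Delta_{pq}=0$ for $p\neq q$. Let $\mathcal{Q}$ be the real vector space of all objects $Q=q_0+q_1\,\mathbf{e}_i+q_2\,\mathbf{e}_j+q_3\,\mathbf{e}_k$ with $q_0,\dots,q_3\in\mathbb{R}$ (a scalar part plus a vector part in $V$). A pure quaternion is an element with zero scalar part. The vector product $\wedge_{\mathrm{vec}}$, also written $\times$, is the bilinear product on $V$ with $\mathbf{e}_p\wedge_{\mathrm{vec}}\mathbf{e}_q=\sigma(pq,r)\,\mathbf{e}_r$ when $\{p,q,r\}=\{i,j,k\}$, where $\sigma(pq,r)$ is the sign of the permutation sorting $(p,q,r)$ into $(i,j,k)$, and $\mathbf{e}_p\wedge_{\mathrm{vec}}\mathbf{e}_p=0$; in coordinates it is the usual cross product of $\mathbb{R}^3$. The product on $\mathcal{Q}$ is $Q_1\wedge_{\mathcal{Q}}Q_2=Q_1\cdot Q_2+Q_1\wedge_{\mathrm{vec}}Q_2$ (scalar part plus vector part). Explicitly, for $P=p_0+\mathbf{p}$ and $Q=q_0+\mathbf{q}$ with $p_0,q_0\in\mathbb{R}$, $\mathbf{p},\mathbf{q}\in V$, $$P\wedge_{\mathcal{Q}}Q=p_0q_0+\mathbf{p}\cdot\mathbf{q}+q_0\mathbf{p}+p_0\mathbf{q}+\mathbf{p}\wedge_{\mathrm{vec}}\mathbf{q}.$$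 The conjugate of $Q$ is $Q^*=q_0-q_1\,\mathbf{e}_i-q_2\,\mathbf{e}_j-q_3\,\mathbf{e}_k$, the squared norm is $\vert Q\vert^2=Q\wedge_{\mathcal{Q}}Q^*=q_0^2+q_1^2+q_2^2+q_3^2$, and the inverse of $Q\neq 0$ is $Q^{-1}=Q^*/\vert Q\vert^2$; in particular $A^{-1}=-\mathbf{a}/\vert\mathbf{a}\vert^2$ for $A=0+\mathbf{a}$. For vectors, length, angle, perpendicularity and handedness are the usual Euclidean ones in the coordinates with respect to $\mathbf{e}_i,\mathbf{e}_j,\mathbf{e}_k$: $\vert\mathbf{a}\vert^2=a_1^2+a_2^2+a_3^2=-\mathbf{a}\cdot\mathbf{a}$, the angle $\varphi\in[0,\pi]$ satisfies $a_1b_1+a_2b_2+a_3b_3=\vert\mathbf{a}\vert\vert\mathbf{b}\vert\cos\varphi$, and $\{\mathbf{a},\mathbf{b},\mathbf{e}\}$ is right-handed when the determinant of the coordinate matrix with columns $\mathbf{a},\mathbf{b},\mathbf{e}$ is positive. *)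

(* Defs.v *)
From mathcomp Require Import all_boot all_order all_fingroup all_algebra.
From mathcomp Require Import all_classical all_reals all_analysis.

Set Implicit Arguments.
Unset Strict Implicit.
Unset Printing Implicit Defensive.

Import Order.TTheory GRing.Theory Num.Theory.

Local Open Scope ring_scope.

(* A vector is its row of coordinates; the labels i < j < k are 0, 1, 2. *)
Notation vec R := 'rV[R]_3.

Section Vectors.
Context {R : realType}.
Implicit Types (p q : 'I_3) (u v a b e : vec R) (phi : R).

Definition basis p : vec R := delta_mx 0 p.

Definition Delta p q : R := if p == q then -1 else 0.

Definition dot u v : R := \sum_p \sum_q u 0 p * v 0 q * Delta p q.

(* The orderings (p, q, r) of the labels are the triples (s 0, s 1, s 2) for
   s in 'S_3. The permutation sorting such a triple is s^-1, whose sign is that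
   of s. The terms with p = q are absent; see cross_basis and cross_basisxx. *)
Definition cross u v : vec R :=
  \sum_(s : 'S_3) ((-1) ^+ s * (u 0 (s 0) * v 0 (s 1))) *: basis (s 2).

Definition edot u v : R := \sum_p u 0 p * v 0 p.

(* Not `|u|, which is the sup norm on matrices. *)
Definition enorm u : R := Num.sqrt (edot u u).

Definition is_angle a b phi : Prop :=
  0 <= phi <= pi /\ edot a b = enorm a * enorm b * cos phi.

Definition perpendicular u v : Prop := edot u v = 0.

Definition right_handed a b e : Prop :=
  0 < \det (\matrix_(p < 3, c < 3) [:: a; b; e]`_c 0 p).

Lemma cross_basis (s : 'S_3) :
  cross (basis (s 0)) (basis (s 1)) = (-1) ^+ s *: basis (s 2).
Proof.
rewrite /cross (bigD1 s) //= big1 ?addr0 => [|t ts]; last first.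
  rewrite !mxE /=; have [t0|] := eqVneq (t 0) (s 0); last first.
    by rewrite mul0r mulr0 scale0r.
  have [t1|] := eqVneq (t 1) (s 1); last by rewrite !mulr0 scale0r.
  case/eqP: ts; apply/permP => x.
  have t2 : t 2 = s 2.
    have n0 : t 2 != s 0 by rewrite -t0 (inj_eq perm_inj).
    have n1 : t 2 != s 1 by rewrite -t1 (inj_eq perm_inj).
    have m0 : s 2 != s 0 by rewrite (inj_eq perm_inj).
    have m1 : s 2 != s 1 by rewrite (inj_eq perm_inj).
    have m2 : s 0 != s 1 by rewrite (inj_eq perm_inj).
    move: n0 n1 m0 m1 m2; move: (t 2) (s 2) (s 0) (s 1).
    by do 4!case=> [] [|[|[|//]]] ?; move=> *; apply/val_inj.
  case: x => [] [|[|[|//]]] lt_x.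
  - by rewrite (_ : Ordinal _ = 0) //; apply/val_inj.
  - by rewrite (_ : Ordinal _ = 1) //; apply/val_inj.
  - by rewrite (_ : Ordinal _ = 2) //; apply/val_inj.
by rewrite !mxE !eqxx !mulr1.
Qed.

Lemma cross_basisxx p : cross (basis p) (basis p) = 0.
Proof.
rewrite /cross big1 // => s _; rewrite !mxE /=.
have [s0|] := eqVneq (s 0) p; last by rewrite mul0r mulr0 scale0r.
have /negbTE-> : s 1 != p by rewrite -s0 (inj_eq perm_inj).
by rewrite !mulr0 scale0r.
Qed.

Lemma crossC u v : cross v u = - cross u v.
Proof.
rewrite /cross -sumrN (reindex_inj (mulgI (tperm 0 1))) /=.
apply: eq_bigr => s _.
rewrite !permM tpermL tpermR tpermD // odd_mul_tperm /= signrN.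
by rewrite mulNr scaleNr (mulrC (v 0 _)).
Qed.

Lemma crossvv u : cross u u = 0.
Proof.
apply/eqP; have /eqP := crossC u u.
by rewrite -addr_eq0 -mulr2n -scaler_nat scaler_eq0 pnatr_eq0.
Qed.

Lemma crossvN u v : cross u (- v) = - cross u v.
Proof.
by rewrite /cross -sumrN; apply: eq_bigr => s _; rewrite mxE !mulrN scaleNr.
Qed.

Lemma dotE u v : dot u v = - edot u v.
Proof.
rewrite /dot /edot -sumrN; apply: eq_bigr => p _.
rewrite (bigD1 p) //= big1 => [|q qp]; rewrite /Delta.
  by rewrite eqxx mulrN1 addr0.
by rewrite eq_sym (negbTE qp) mulr0.
Qed.

End Vectors.

(* Scalar part and vector part, with the componentwise real vector space
   structure (R^o is R as a module over itself). *)
Notation quat R := (R^o * vec R)%type.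

Section Quaternions.
Context {R : realType}.
Implicit Types (x : R) (v : vec R) (P Q : quat R).

Definition qscal x : quat R := (x, 0).

Definition qvec v : quat R := (0, v).

Definition qmul P Q : quat R :=
  (P.1 * Q.1 + dot P.2 Q.2, Q.1 *: P.2 + P.1 *: Q.2 + cross P.2 Q.2).

Definition qconj Q : quat R := (Q.1, - Q.2).

Definition qnorm2 Q : R := Q.1 ^+ 2 + \sum_p Q.2 0 p ^+ 2.

Definition qinv Q : quat R := (qnorm2 Q)^-1 *: qconj Q.

Lemma qmul_conj Q : qmul Q (qconj Q) = qscal (qnorm2 Q).
Proof.
rewrite /qmul /qconj /qscal /qnorm2 /= dotE crossvN crossvv oppr0 addr0.
rewrite scalerN subrr expr2 /edot -sumrN; congr (_ + _, _).
by apply: eq_bigr => p _; rewrite mxE mulrN opprK expr2.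
Qed.

End Quaternions.

(* Main.v *)
(** Since [e] is a unit vector orthogonal to [a] and [b], [cross a b] is
    [d *: e] with [d] the triple product of [a], [b], [e], positive by
    right-handedness. Lagrange's identity gives [d = |a| |b| sin phi], and both
    equalities follow: the vector part of [B A^-1] is [cross a b / |a|^2], and
    [cross (cross a b) a = |a|^2 b - (a, b) a]. *)

Require Import Defs.
From mathcomp Require Import all_boot all_order all_fingroup all_algebra.
From mathcomp Require Import all_classical all_reals all_analysis.
From mathcomp Require Import ring.

Set Implicit Arguments.
Unset Strict Implicit.
Unset Printing Implicit Defensive.

Import Order.TTheory GRing.Theory Num.Theory.

Local Open Scope ring_scope.

Section PureQuaternions.
Context {R : realType}.
Implicit Types (u v w a b e : vec R) (k phi : R).

(** Pairing [basis (s 2)] with [w] leaves [w 0 (s 2)], so the sum over ['S_3] defining [cross]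
    becomes the Leibniz formula, read on the transpose because the vectors are columns. *)
Lemma edot_cross u v w :
  edot (cross u v) w = \det (\matrix_(p < 3, c < 3) [:: u; v; w]`_c 0 p).
Proof.
rewrite -det_tr /determinant /edot.
under eq_bigr do rewrite /cross summxE mulr_suml.
rewrite exchange_big /=; apply: eq_bigr => s _.
rewrite (bigD1 (s 2)) //= big1 ?addr0 => [|p /negbTE ps]; last first.
  by rewrite !mxE /= ps mulr0 mul0r.
rewrite !big_ord_recr big_ord0 /= mul1r !mxE !eqxx mulr1 -!mulrA.
by congr (_ * (u 0 (s _) * (v 0 (s _) * w 0 (s _)))); apply/val_inj.
Qed.

Lemma edotE u v : edot u v = u 0 0 * v 0 0 + u 0 1 * v 0 1 + u 0 2 * v 0 2.
Proof.
rewrite /edot !big_ord_recr big_ord0 /= add0r.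
by congr (u 0 _ * v 0 _ + u 0 _ * v 0 _ + u 0 _ * v 0 _); apply/val_inj.
Qed.

Lemma vec_eqP u v :
  u 0 0 = v 0 0 -> u 0 1 = v 0 1 -> u 0 2 = v 0 2 -> u = v.
Proof.
move=> e0 e1 e2; apply/rowP => -[[|[|[|//]]] lt_p].
- by rewrite (_ : Ordinal _ = 0) //; apply/val_inj.
- by rewrite (_ : Ordinal _ = 1) //; apply/val_inj.
- by rewrite (_ : Ordinal _ = 2) //; apply/val_inj.
Qed.

Lemma triple_productE u v w : edot (cross u v) w =
  (u 0 1 * v 0 2 - u 0 2 * v 0 1) * w 0 0 +
  (u 0 2 * v 0 0 - u 0 0 * v 0 2) * w 0 1 +
  (u 0 0 * v 0 1 - u 0 1 * v 0 0) * w 0 2.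
Proof.
rewrite edot_cross (expand_det_col _ 2) !big_ord_recr big_ord0 /= add0r.
rewrite /cofactor !(expand_det_col _ 0) !big_ord_recr !big_ord0 /= !add0r.
rewrite /cofactor !det_mx11 !mxE /=.
(* The cofactor expansions leave lifted ordinals as indices; naming coordinates by natural numbers
   lets [ring] identify equal ones. *)
pose coord (x : vec R) (n : nat) : R := x 0 (inord n).
have coordE (x : vec R) p : x 0 p = coord x p by rewrite /coord inord_val.
rewrite !coordE /= /bump /=.
ring.
Qed.

(** Each coordinate is a triple product with a basis vector. The equations are paired by [*] to
    serve as one rewriting multirule. *)
Lemma crossE u v :
  (cross u v 0 0 = u 0 1 * v 0 2 - u 0 2 * v 0 1) *
  (cross u v 0 1 = u 0 2 * v 0 0 - u 0 0 * v 0 2) *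
  (cross u v 0 2 = u 0 0 * v 0 1 - u 0 1 * v 0 0).
Proof.
have dotb p : cross u v 0 p = edot (cross u v) (Defs.basis p).
  rewrite /edot (bigD1 p) //= big1 ?addr0 => [|q /negbTE qp].
    by rewrite mxE !eqxx mulr1.
  by rewrite mxE qp mulr0.
by split; first split; rewrite dotb triple_productE !mxE /=; ring.
Qed.

Lemma edotC u v : edot u v = edot v u.
Proof. by rewrite !edotE; ring. Qed.

Lemma edotvv_ge0 u : 0 <= edot u u.
Proof. by apply: sumr_ge0 => p _; rewrite -expr2 sqr_ge0. Qed.

Lemma sqr_enorm u : enorm u ^+ 2 = edot u u.
Proof. exact/sqr_sqrtr/edotvv_ge0. Qed.

Lemma enorm_eq0 u : (enorm u == 0) = (u == 0).
Proof.
rewrite -sqrf_eq0 sqr_enorm; apply/eqP/eqP => [/psumr_eq0P u0|->].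
  apply/rowP => p; apply/eqP; rewrite mxE -sqrf_eq0 expr2 u0 //.
  by move=> q _; rewrite -expr2 sqr_ge0.
by rewrite /edot big1 // => p _; rewrite mxE mul0r.
Qed.

Lemma crossZl k u v : cross (k *: u) v = k *: cross u v.
Proof. by apply: vec_eqP; rewrite !(crossE, mxE); ring. Qed.

Lemma edotZl k u v : edot (k *: u) v = k * edot u v.
Proof. by rewrite !edotE !mxE; ring. Qed.

Lemma edotZr k u v : edot u (k *: v) = k * edot u v.
Proof. by rewrite edotC edotZl edotC. Qed.

Lemma cross_crossl u v w :
  cross (cross u v) w = edot u w *: v - edot v w *: u.
Proof. by apply: vec_eqP; rewrite !(crossE, mxE, edotE); ring. Qed.

Lemma Lagrange_identity u v :
  edot (cross u v) (cross u v) = edot u u * edot v v - edot u v ^+ 2.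
Proof. by rewrite !edotE !crossE; ring. Qed.

(** The double cross product formula makes [cross (cross a b) e] vanish, so [cross a b] is parallel
    to [e]. *)
Lemma cross_perpendicular a b e :
  enorm e = 1 -> perpendicular e a -> perpendicular e b ->
  cross a b = edot (cross a b) e *: e.
Proof.
rewrite /perpendicular => e1 ea eb.
have abe0 : cross (cross a b) e = 0.
  by rewrite cross_crossl !(edotC _ e) ea eb !scale0r subr0.
(* The left side is zero, and the right side is [cross a b] minus its component along the unit
   vector [e]. *)
have := cross_crossl e (cross a b) e.
rewrite -sqr_enorm e1 expr1n scale1r (crossC (cross a b) e) abe0 oppr0.
by rewrite -(scale0r e) crossZl scale0r => /eqP; rewrite eq_sym subr_eq0 => /eqP.
Qed.

Lemma cross_sin a b e phi :
  is_angle a b phi -> enorm e = 1 -> perpendicular e a -> perpendicular e b ->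
  right_handed a b e -> cross a b = (enorm a * enorm b * sin phi) *: e.
Proof.
move=> [phi_itv ab] e1 ea eb; rewrite /right_handed -edot_cross => d_gt0.
have abE := cross_perpendicular e1 ea eb.
rewrite abE; congr (_ *: _); apply/eqP.
have sin_phi_ge0 : 0 <= sin phi by rewrite sin_ge0_pi.
(* Both coefficients are nonnegative, so comparing squares suffices; Lagrange's identity supplies
   the square of the triple product. *)
rewrite -(@eqrXn2 _ 2) ?(ltW d_gt0) ?mulr_ge0 ?sqrtr_ge0 //.
have := Lagrange_identity a b.
(* Only the two factors in Lagrange's identity are replaced; the triple product in the goal
   stays. *)
rewrite {1 2}abE edotZl edotZr -(sqr_enorm e) e1 expr1n mulr1 -expr2.
rewrite ab -!sqr_enorm => ->.
by rewrite !exprMn sin2cos2 mulrBr mulr1.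
Qed.

Lemma qmul_qvec u v : qmul (qvec u) (qvec v) = (- edot u v, cross u v).
Proof. by rewrite /qmul /= mulr0 !add0r !scale0r !add0r dotE. Qed.

Lemma qinv_qvec v : qinv (qvec v) = qvec (- (enorm v ^- 2 *: v)).
Proof.
have normv : qnorm2 (qvec v) = enorm v ^+ 2.
  by rewrite /qnorm2 /= expr0n add0r sqr_enorm.
by rewrite /qinv normv /qconj; congr (_, _); rewrite /= ?scalerN ?[LHS]mulr0.
Qed.

End PureQuaternions.

Theorem mainTheorem6 (R : realType) (a b e : vec R) (phi : R)
  (a_neq0 : a != 0) (b_neq0 : b != 0)
  (norm_ab : enorm a = enorm b)
  (angle_ab : is_angle a b phi)
  (e_unit : enorm e = 1)
  (perp_ea : perpendicular e a) (perp_eb : perpendicular e b)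
  (rh_abe : right_handed a b e) :
  let A : quat R := qvec a in
  let B : quat R := qvec b in
  let Q : quat R := qscal (cos phi) + sin phi *: qvec e in
  qscal (cos phi) + sin phi *: qvec e = qmul B (qinv A) /\
  B = qmul Q A /\
  qmul Q A = qvec (cos phi *: a + sin phi *: cross e a).
Proof.
move=> A B Q.
have abE := cross_sin angle_ab e_unit perp_ea perp_eb rh_abe.
have edot_ab : edot a b = enorm a ^+ 2 * cos phi.
  by case: angle_ab => _ ->; rewrite -norm_ab expr2.
rewrite -norm_ab -expr2 in abE.
have a2_neq0 : enorm a ^+ 2 != 0 by rewrite sqrf_eq0 enorm_eq0.
have QE : Q = (cos phi, sin phi *: e).
  by rewrite /Q /qscal /qvec; congr (_, _) => /=; rewrite ?scaler0 ?addr0 ?add0r.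
(* The scalar part is [- (sin phi * edot e a)], which vanishes by perpendicularity. *)
have QAE : qmul Q A = qvec (cos phi *: a + sin phi *: cross e a).
  rewrite QE /qmul /A /qvec /= mulr0 add0r scale0r add0r crossZl dotE.
  by rewrite edotZl [edot e a]perp_ea mulr0 oppr0.
split; last split=> //.
  (* The minus sign of the inverse turns [cross b a] into [cross a b]; both parts then carry a
     factor [enorm a ^+ 2] that cancels. *)
  rewrite -/Q QE /A qinv_qvec qmul_qvec crossvN -crossC crossZl abE.
  rewrite -scaleNr edotZr edotC edot_ab mulNr opprK scalerA.
  by rewrite !mulKf.
(* After scaling by [enorm a ^+ 2], the claim is the expansion of [cross (cross a b) a] solved for
   [b]. *)
rewrite QAE; congr (_, _); apply: (scalerI a2_neq0).
have := cross_crossl a b a.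
rewrite abE crossZl -sqr_enorm (edotC b) edot_ab => /eqP.
rewrite eq_sym subr_eq => /eqP ->.
by rewrite scalerDr !scalerA addrC.
Qed.
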